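(* Let $Q$ be a quasigroup in the variety $\mathbf{P}$ of semisymmetric quasigroups. Then the universal multiplication group $\widetilde{G}=U(Q;\mathbf{P})$ is free over the set $\widetilde{R}(Q)=\{\widetilde{R}(q)\mid q\in Q\}$.
   Context: A quasigroup $(Q,\cdot,/,\backslash)$ is a set with three binary operations satisfying $y\backslash(y\cdot x)=x$, $x=(x\cdot y)/y$, $y\cdot(y\backslash x)=x$, $x=(x/y)\cdot y$. It is semisymmetric if $(yx)y=x$ for all $x,y$; equivalently $y(xy)=x$, equivalently $y\backslash x=xy$, equivalently $y/x=xy$. $\mathbf{P}$ is the variety (category) of semisymmetric quasigroups, with quasigroup homomorphisms. $Q[X]$ is the coproduct in $\mathbf{P}$ of $Q$ with the free semisymmetric quasigroup on the one-element set $\{X\}$; the canonical map $Q\to Q[X]$ is injective and $Q$ is regarded as a subquasigroup of $Q[X]$. For $q\in Q$, $\widetilde{R}(q):u\mapsto uq$ and $\widetilde{L}(q):u\mapsto qu$ are the right and left multiplications by $q$ on the set $Q[X]$; they are permutations of $Q[X]$. The universal multiplication group $U(Q;\mathbf{P})$ is the subgroup of the symmetric group on the set $Q[X]$ generated by all $\widetilde{R}(q),\widetilde{L}(q)$, $q\in Q$. Permutations act on the right and are composed left to right. *)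

(* Defs.v *)
From HB Require Import structures.
From mathcomp Require Import all_boot.
From mathcomp Require Import boolp classical_sets.

Set Implicit Arguments.
Unset Strict Implicit.
Unset Printing Implicit Defensive.

Declare Scope quasigroup_scope.
Delimit Scope quasigroup_scope with Q.

HB.mixin Record isQuasigroup Q := {
  qmul : Q -> Q -> Q;
  qrdiv : Q -> Q -> Q;
  qldiv : Q -> Q -> Q;  (* qldiv y x is y \ x *)
  qmulKl : forall y x, qldiv y (qmul y x) = x;
  qmulKr : forall y x, qrdiv (qmul x y) y = x;
  qldivK : forall y x, qmul y (qldiv y x) = x;
  qrdivK : forall y x, qmul (qrdiv x y) y = x
}.

#[short(type="quasigroupType")]
HB.structure Definition Quasigroup := {Q of isQuasigroup Q}.

Notation "x * y" := (qmul x y) : quasigroup_scope.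
Notation "x / y" := (qrdiv x y) : quasigroup_scope.
Notation "y \\ x" := (qldiv y x)
  (at level 40, left associativity) : quasigroup_scope.

HB.mixin Record Quasigroup_isSemisymmetric Q of Quasigroup Q := {
  qsemisym : forall x y : Q, ((y * x) * y)%Q = x
}.

#[short(type="semisymType")]
HB.structure Definition Semisym :=
  {Q of Quasigroup Q & Quasigroup_isSemisymmetric Q}.

Section Category.
Local Open Scope quasigroup_scope.

Definition quasigroup_hom (A B : quasigroupType) (f : A -> B) : Prop :=
  [/\ {morph f : x y / x * y}, {morph f : x y / x / y}
    & {morph f : x y / x \\ y}].

Definition is_free_on_one (F : semisymType) (X : F) : Prop :=
  forall (P : semisymType) (p : P),
    exists! h : F -> P, quasigroup_hom h /\ h X = p.

Definition is_coproduct (A B C : semisymType) (i : A -> C) (j : B -> C) :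
    Prop :=
  [/\ quasigroup_hom i, quasigroup_hom j &
    forall (P : semisymType) (f : A -> P) (g : B -> P),
      quasigroup_hom f -> quasigroup_hom g ->
      exists! h : C -> P, [/\ quasigroup_hom h, h \o i =1 f & h \o j =1 g]].

End Category.

(* The symmetric group on an arbitrary, possibly infinite, type. *)
Record permutation (T : Type) := Permutation {
  sym_fun :> T -> T;
  sym_inv : T -> T;
  sym_funK : cancel sym_fun sym_inv;
  sym_invK : cancel sym_inv sym_fun
}.

Section SymmetricGroup.
Variable T : Type.
Implicit Types s t : permutation T.

Lemma permutationP s t : s =1 t -> s = t.
Proof.
case: s t => [f f' fK f'K] [g g' gK g'K] /= /funext fg.
rewrite -{}fg in gK g'K *.
have ff' : f' = g' by apply/funext => x; rewrite -[in LHS](g'K x) fK.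
by rewrite -{}ff' in gK g'K *; congr Permutation; exact: Prop_irrelevance.
Qed.

Definition sym_one : permutation T := @Permutation T id id (frefl _) (frefl _).

(* Permutations act on the right, so s * t means s followed by t. *)
Definition sym_mul s t : permutation T :=
  Permutation (can_comp (sym_funK t) (sym_funK s))
            (can_comp (sym_invK s) (sym_invK t)).

Definition sym_invg s : permutation T := Permutation (sym_invK s) (sym_funK s).

Fact sym_mulA : associative sym_mul.
Proof. by move=> s t u; exact: permutationP. Qed.

Fact sym_mul1 : left_id sym_one sym_mul.
Proof. by move=> s; exact: permutationP. Qed.

Fact sym_mulr1 : right_id sym_one sym_mul.
Proof. by move=> s; exact: permutationP. Qed.

Fact sym_mulV : left_inverse sym_one sym_invg sym_mul.
Proof. by move=> s; apply: permutationP => x /=; rewrite sym_invK. Qed.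

Fact sym_mulrV : right_inverse sym_one sym_invg sym_mul.
Proof. by move=> s; apply: permutationP => x /=; rewrite sym_funK. Qed.

HB.instance Definition _ := gen_eqMixin (permutation T).
HB.instance Definition _ := gen_choiceMixin (permutation T).
HB.instance Definition _ := isGroup.Build (permutation T)
  sym_mulA sym_mul1 sym_mulr1 sym_mulV sym_mulrV.

End SymmetricGroup.

Section GeneratedSubgroup.
Local Open Scope classical_set_scope.
Variables (G : groupType) (S : set G).

Definition generated : set G :=
  smallest (fun H : set G => group_closed (mem H)) S.

Definition generated_group : Type := {x : G | x \in generated}.

Fact generated_closed : group_closed (mem generated).
Proof.
split=> [|x y]; rewrite !inE.
  by move=> H [[H1 _] _]; move: H1; rewrite inE.
move=> genx geny H SH; have [[_ HV] _] := SH.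
by have := HV x y; rewrite !inE; apply; [exact: genx | exact: geny].
Qed.

HB.instance Definition _ := SubChoice.on generated_group.
HB.instance Definition _ :=
  SubChoice_isSubGroup.Build G _ generated_group generated_closed.

End GeneratedSubgroup.

Definition free_over (G : groupType) (S : set G) : Prop :=
  forall (H : groupType) (f : S -> H),
    exists! phi : G -> H,
      monoid_morphism phi /\ forall s : S, phi (val s) = f s.

Arguments free_over G S : clear implicits.

Section Multiplications.
Variable A : quasigroupType.

Definition Rmul (a : A) : permutation A :=
  @Permutation A (fun u => u * a)%Q (fun u => u / a)%Q (qmulKr a) (qrdivK a).

Definition Lmul (a : A) : permutation A :=
  @Permutation A (fun u => a * u)%Q (fun u => a \\ u)%Q (qmulKl a) (qldivK a).

End Multiplications.

Section UniversalMultiplicationGroup.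
Local Open Scope classical_set_scope.
(* QX stands for Q[X]; the canonical map i identifies Q with a subquasigroup. *)
Variables (Q QX : semisymType) (i : Q -> QX).

Definition univ_mul_group : groupType :=
  generated_group ([set Rmul (i q) | q in [set: Q]] `|`
                   [set Lmul (i q) | q in [set: Q]]).

Definition univ_Rmul : set univ_mul_group :=
  [set u | exists q : Q, val u = Rmul (i q)].

End UniversalMultiplicationGroup.

Arguments univ_Rmul {Q QX} i.

(* Main.v *)
(* Given f : Q -> H, we build a semisymmetric quasigroup P containing Q together
   with a set of points on which Q acts on the right through f; sending X to a
   point whose translates are pairwise distinct shows that a product of right
   multiplications acting trivially on Q[X] is sent to 1 by f. Left
   multiplications are the inverses of right ones, so they add no generator.

   Semisymmetry says that the graph of the product is invariant under cyclic
   shifts, so it suffices to define a * b and m * a for scalars a, b and points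
   m in such a way that scalars form a semisymmetric quasigroup and that
   (m, a) |-> m * a is a Latin square; a * m and n * m follow. Writing Z for the
   Boolean group of subsets of H, scalars and points are both pairs in Z x Q,
     (z, q) * (z', q') = (z + z', q q')             for scalars,
     (z, q) * (z', q') = ((z + z') . f(q'), q q')   for a point and a scalar,
   and Q embeds in the scalars as 0 x Q. *)
Require Import Defs.
From HB Require Import structures.
From mathcomp Require Import all_boot.
From mathcomp Require Import boolp classical_sets.

Set Implicit Arguments.
Unset Strict Implicit.
Unset Printing Implicit Defensive.

Section Semisymmetric.
Local Open Scope quasigroup_scope.

Lemma semisymV (P : semisymType) (x y : P) : y * (x * y) = x.
Proof. by rewrite -{1}(qsemisym y x) (qsemisym x (x * y)). Qed.

Lemma semisym_ldiv (P : semisymType) (x y : P) : y \\ x = x * y.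
Proof. by rewrite -{1}(semisymV x y) qmulKl. Qed.

Lemma semisym_rdiv (P : semisymType) (x y : P) : x / y = y * x.
Proof. by rewrite -{1}(qsemisym x y) qmulKr. Qed.

Lemma semisym_hom (A B : semisymType) (f : A -> B) :
  {morph f : x y / x * y} -> quasigroup_hom f.
Proof.
move=> fM; split=> // x y.
  by rewrite !semisym_rdiv fM.
by rewrite !semisym_ldiv fM.
Qed.

End Semisymmetric.

Section GeneratedSubgroup.
Local Open Scope group_scope.
Local Open Scope classical_set_scope.

(** The elements satisfying [P] form a subgroup that contains [S]. *)
Lemma generated_group_ind (G : groupType) (S : set G)
    (P : generated_group S -> Prop) :
  P 1 -> (forall x y, P x -> P y -> P (x * y^-1)) ->
  (forall x, S (val x) -> P x) -> forall x, P x.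
Proof.
move=> P1 PV PS x; pose K := [set g | exists2 y, val y = g & P y].
suff [y /val_inj <- //] : K (val x).
have /set_mem := valP x; apply; split.
  split=> [|_ _ /set_mem[y <- Py] /set_mem[z <- Pz]]; apply/mem_set.
    by exists 1.
  by exists (y * z^-1); last exact: PV.
move=> g Sg; have gS : g \in generated S by apply/mem_set => H [_]; exact.
by exists (exist _ g gS); last exact: PS.
Qed.

End GeneratedSubgroup.

Section Translation.
Local Open Scope group_scope.
Variable H : groupType.
Implicit Types (g h : H) (z : H -> bool).

Definition translate g z : H -> bool := fun x => z (x * g^-1).

Lemma translate1 : translate 1 =1 id.
Proof. by move=> z; apply/funext => x; rewrite /translate invg1 mulg1. Qed.

Lemma translateM g h z : translate (g * h) z = translate h (translate g z).
Proof. by apply/funext => x; rewrite /translate invgM mulgA. Qed.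

Lemma translateK g : cancel (translate g) (translate g^-1).
Proof. by move=> z; rewrite -translateM mulgV translate1. Qed.

Lemma translateVK g : cancel (translate g^-1) (translate g).
Proof. by move=> z; rewrite -translateM mulVg translate1. Qed.

(** The translate by [g] of the singleton of [1] is the singleton of [g]. *)
Lemma translate_pred1_inj : injective (translate^~ (xpred1 (1 : H))).
Proof.
move=> g h /(congr1 (@^~ g)); rewrite /translate /= mulgV eqxx.
by move/esym/eqP/divg1_eq.
Qed.

End Translation.

Section SymmetricDifference.
Variable T : Type.
Implicit Types z : T -> bool.

Definition symdiff z1 z2 : T -> bool := fun x => z1 x (+) z2 x.

Lemma symdiff0 z : symdiff z xpred0 = z.
Proof. by apply/funext => x; rewrite /symdiff addbF. Qed.

Lemma symdiffC : commutative symdiff.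
Proof. by move=> z1 z2; apply/funext => x; rewrite /symdiff addbC. Qed.

Lemma symdiffK z : involutive (symdiff^~ z).
Proof. by move=> z'; apply/funext => x; rewrite /symdiff addbK. Qed.

Lemma symdiffKl z : involutive (symdiff z).
Proof. by move=> z'; rewrite !(symdiffC z) symdiffK. Qed.

End SymmetricDifference.

Section Extension.
Local Open Scope quasigroup_scope.
Variables (Q : semisymType) (H : groupType).

(* Scalars on the left, points on the right; the type carries f because its
   quasigroup structure depends on it. *)
Definition extension (_ : Q -> H) : Type :=
  ((H -> bool) * Q) + ((H -> bool) * Q).

Variable f : Q -> H.

(** Cyclic invariance dictates the last two cases: [a * m] is the point [n] with [n * a = m], and
    [n * m] is the scalar [a] with [m * a = n]. *)
Definition ext_mul (u v : extension f) : extension f :=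
  match u, v with
  | inl (z1, q1), inl (z2, q2) => inl (symdiff z1 z2, q1 * q2)
  | inr (z1, q1), inl (z2, q2) =>
      inr (translate (f q2) (symdiff z1 z2), q1 * q2)
  | inl (z1, q1), inr (z2, q2) =>
      inr (symdiff (translate (f q1)^-1%g z2) z1, q2 / q1)
  | inr (z1, q1), inr (z2, q2) =>
      let q := q2 \\ q1 in inl (symdiff (translate (f q)^-1%g z1) z2, q)
  end.

Lemma ext_mulKr y x : ext_mul (ext_mul y x) y = x.
Proof.
case: y x => [[z q]|[z q]] [[z' q']|[z' q']] /=.
- by rewrite symdiffC symdiffKl qsemisym.
- by rewrite symdiffK translateVK qrdivK.
- by rewrite qmulKl translateK symdiffC symdiffKl.
- by rewrite symdiffKl semisym_rdiv semisym_ldiv qsemisym.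
Qed.

Lemma ext_mulKl y x : ext_mul y (ext_mul x y) = x.
Proof. by rewrite -{1}(ext_mulKr x y) (ext_mulKr (ext_mul x y)). Qed.

HB.instance Definition _ := isQuasigroup.Build (extension f)
  (qmul := ext_mul) (qrdiv := fun x y => ext_mul y x)
  (qldiv := fun y x => ext_mul x y)
  ext_mulKr ext_mulKl ext_mulKl ext_mulKr.
HB.instance Definition _ := Quasigroup_isSemisymmetric.Build (extension f)
  (fun x y => ext_mulKr y x).

Definition ext_scalar (q : Q) : extension f := inl (xpred0, q).

(** Without the coordinate in [Q], right multiplication by [ext_scalar q] acts on points purely as
    translation by [f q]. *)
Definition ext_point (u : extension f) : option (H -> bool) :=
  if u is inr (z, _) then Some z else None.

Lemma ext_scalarM : {morph ext_scalar : x y / x * y}.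
Proof. by move=> x y; congr (inl (_, _)); rewrite symdiff0. Qed.

Lemma ext_point_scalar (u : extension f) q :
  ext_point (u * ext_scalar q) = omap (translate (f q)) (ext_point u).
Proof. by case: u => [[z q']|[z q']] //=; rewrite symdiff0. Qed.

End Extension.

Section UniversalMultiplicationGroup.
Local Open Scope group_scope.
Variables (Q QX : semisymType) (i : Q -> QX).
Let G := univ_mul_group i.

Lemma Rmul_generated q :
  Rmul (i q) \in generated ([set Rmul (i q) | q in [set: Q]] `|`
                            [set Lmul (i q) | q in [set: Q]])%classic.
Proof. by apply/mem_set => K [_]; apply; left; exists q. Qed.

Definition univ_R q : G := exist _ (Rmul (i q)) (Rmul_generated q).

Lemma univ_RP q : univ_R q \in univ_Rmul i.
Proof. by apply/mem_set; exists q. Qed.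

Lemma univ_mul_group_ind (P : G -> Prop) :
  P 1 -> (forall x y, P x -> P y -> P (x * y^-1)) ->
  (forall q, P (univ_R q)) -> forall x, P x.
Proof.
move=> P1 PV PR; apply: generated_group_ind => // x [] [q _ qx].
  by rewrite (_ : x = univ_R q) //; exact: val_inj.
(* Here [x] is a left multiplication, the inverse of a right one by semisymmetry. *)
rewrite (_ : x = 1 * (univ_R q)^-1); first exact: PV.
apply: val_inj; rewrite -qx; apply: permutationP => u /=.
by rewrite semisym_rdiv.
Qed.

Lemma univ_mul_group_hom_eq (H : groupType) (phi psi : G -> H) :
  monoid_morphism phi -> monoid_morphism psi ->
  (forall q, phi (univ_R q) = psi (univ_R q)) -> phi =1 psi.
Proof.
move=> [phi1 phiM] [psi1 psiM] eqR.
apply: univ_mul_group_ind => // [|x y eqx eqy].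
  by rewrite phi1 psi1.
have phiV z : phi z^-1 = (phi z)^-1.
  by apply/esym/(@mulgI _ (phi z)); rewrite mulgV -phiM mulgV.
have psiV z : psi z^-1 = (psi z)^-1.
  by apply/esym/(@mulgI _ (psi z)); rewrite mulgV -psiM mulgV.
by rewrite phiM psiM phiV psiV eqx eqy.
Qed.

(** One [h] serves all [u]: it is the candidate image of [x] in [H], obtained without choosing a
    word for [x]. *)
Lemma ext_point_act (H : groupType) (f : Q -> H) (p : QX -> extension f) :
  quasigroup_hom p -> (forall q, p (i q) = ext_scalar f q) ->
  forall x : G, exists h, forall u,
    ext_point (p (val x u)) = omap (translate h) (ext_point (p u)).
Proof.
move=> [pM _ _] pi; apply: univ_mul_group_ind => [|x y [g xg] [h yh]|q].
- by exists 1 => u /=; case: ext_point => //= z; rewrite translate1.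
- exists (g * h^-1) => u.
  (* Applying [y] to this argument gives back [val x u], so translation by [h] can be undone. *)
  have := yh (val y^-1 (val x u)); rewrite [val y _]sym_invK xg /=.
  case: ext_point => [z|]; case: ext_point => //= z' [zz'].
  by congr Some; rewrite translateM zz' translateK.
- by exists (f q) => u /=; rewrite pM pi ext_point_scalar.
Qed.

End UniversalMultiplicationGroup.

Theorem theorem3p6 (Q F QX : semisymType) (X : F) (i : Q -> QX) (j : F -> QX)
    (free_FX : is_free_on_one X) (coprod_QX : is_coproduct i j) :
  free_over (univ_mul_group i) (univ_Rmul i).
Proof.
move=> H f.
pose f' q := f (exist _ (univ_R i q) (univ_RP i q)).
have fE (s : univ_Rmul i) : exists2 q, val s = univ_R i q & f s = f' q.
  have /set_mem[q sq] := valP s; have sR : val s = univ_R i q by exact: val_inj.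
  by exists q => //; congr f; exact: val_inj.
suff [phi [phiM phiR]] :
    exists phi : univ_mul_group i -> H,
      monoid_morphism phi /\ forall q, phi (univ_R i q) = f' q.
  exists phi; split=> [|psi [psiM psif]].
    by split=> // s; have [q -> ->] := fE s.
  apply/funext/univ_mul_group_hom_eq => // q.
  by rewrite phiR /f' -psif.
(* For empty [Q] the extension has no point to which [X] could go, but then there are no generators
   and the trivial map works. *)
have [[q0]|Q0] := pselect (inhabited Q); last first.
  exists (fun=> 1%g); split=> [|q]; last by case: Q0; exists.
  by split=> // x y; rewrite mulg1.
have [g [[g_hom gX] _]] :=
  free_FX (extension f') (inr (xpred1 (1%g : H), q0) : extension f').
have [_ _ univ] := coprod_QX.
have [p [[p_hom pi pj] _]] :=
  univ _ _ _ (semisym_hom (ext_scalarM f')) g_hom.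
have [phi phiP] := choice (ext_point_act p_hom pi).
(* Since [X] goes to a point with distinct translates, the action on [X] alone determines [phi x];
   this makes the chosen [phi] multiplicative. *)
have phi_uniq (x : univ_mul_group i) h : ext_point (p (val x (j X))) =
    omap (translate h) (ext_point (p (j X))) -> phi x = h.
  by rewrite phiP [p _]pj gX /= => -[/translate_pred1_inj].
exists phi; split=> [|q]; last first.
  have [pM _ _] := p_hom; apply: phi_uniq.
  by rewrite /= pM [p (i q)]pi ext_point_scalar.
split=> [|x y]; apply: phi_uniq.
  by case: ext_point => //= z; rewrite translate1.
have -> : val (x * y)%g (j X) = val y (val x (j X)) by [].
rewrite !phiP.
by case: ext_point => //= z; rewrite translateM.
Qed.
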